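(* Let $C \geq 1$ be a fixed real number. Then, as the positive integer $k$ tends to infinity, $$f(k,C) \geq \frac{k}{2\ln k}\,(1+o_k(1)),$$ where $f(k,C)$ denotes the minimum possible value of the domatic number $dom(G)$ taken over all $(k,C)$-regular graphs $G$.
   Context: All graphs are finite, undirected and simple. A subset $D$ of vertices of a graph $G$ is a dominating set if every vertex not in $D$ has a neighbor in $D$. The domatic number $dom(G)$ is the maximum number of colors in a (not necessarily proper) vertex coloring of $G$ in which each color class is a dominating set; equivalently, the maximum cardinality of a family of pairwise disjoint dominating sets of $G$. For a positive integer $k$ and a real number $C\ge 1$, a graph $G$ is called $(k,C)$-regular if its minimum degree satisfies $\delta(G)=k$ and its maximum degree satisfies $\Delta(G)\le kC$. $\ln$ is the natural logarithm. $o_k(1)$ denotes a quantity (which may depend on $C$) tending to $0$ as $k\to\infty$ with $C$ fixed. *)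

(* Defs.v *)
From HB Require Import structures.
From mathcomp Require Import all_boot all_order all_algebra.
From mathcomp Require Import all_classical all_reals all_analysis.

Set Implicit Arguments.
Unset Strict Implicit.
Unset Printing Implicit Defensive.

Import Order.TTheory GRing.Theory Num.Theory.
Import numFieldNormedType.Exports.

Local Open Scope classical_set_scope.
Local Open Scope ring_scope.

Record sgraph := SGraph {
  vertex :> finType;
  adj : rel vertex;
  adj_sym : symmetric adj;
  adj_irrefl : irreflexive adj }.

Definition degree (G : sgraph) (x : G) : nat := #|[set y | adj x y]%SET|.

(* The default #|G| exceeds every degree, so it only matters for the graph
   without vertices, whose minimum degree is 0 by convention. *)
Definition min_degree (G : sgraph) : nat :=
  \big[minn/#|G|]_(x : G) degree x.

Definition max_degree (G : sgraph) : nat := (\max_(x : G) degree x)%N.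

Definition dominating (G : sgraph) (D : {set G}) : bool :=
  [forall x, (x \notin D) ==> [exists y in D, adj x y]].

(* A partition of the vertices into m labelled dominating sets; a colour class
   of a graph with a vertex is then nonempty, so every colour is used. *)
Definition domatic_coloring (G : sgraph) (m : nat) (c : {ffun G -> 'I_m}) :
    bool :=
  [forall i, dominating [set x | c x == i]%SET].

(* The bound m <= #|G| loses nothing when G has a vertex: see
   leq_domatic_number. *)
Definition domatic_number (G : sgraph) : nat :=
  (\max_(m < #|G|.+1 | [exists c : {ffun G -> 'I_m}, domatic_coloring c]) m)%N.

Definition kC_regular (R : realType) (k : nat) (C : R) (G : sgraph) : Prop :=
  min_degree G = k /\ (max_degree G)%:R <= k%:R * C.

Definition domatic_values (R : realType) (k : nat) (C : R) : set nat :=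
  [set m | exists G : sgraph, kC_regular k C G /\ domatic_number G = m].

Definition is_minimum (A : set nat) (m : nat) : Prop :=
  A m /\ forall n, A n -> (m <= n)%N.

(* The minimum exists for 1 <= k and 1 <= C (min_domaticP); the default 0 is
   irrelevant there. *)
Definition min_domatic (R : realType) (k : nat) (C : R) : nat :=
  xget 0%N (is_minimum (domatic_values k C)).

Lemma leq_domatic_number (G : sgraph) (m : nat) (c : {ffun G -> 'I_m}) :
  (0 < #|G|)%N -> domatic_coloring c -> (m <= domatic_number G)%N.
Proof.
move=> /card_gt0P[x0 _] cP.
have cs : forall i : 'I_m, exists x, c x == i.
  move=> i; move/forallP/(_ i)/forallP/(_ x0): cP; rewrite inE.
  have [ci _|_ /= /exists_inP[y]] := boolP (c x0 == i); first by exists x0.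
  by rewrite inE => cy _; exists y.
have lem : (m <= #|G|)%N.
  pose g i := xchoose (cs i).
  have gI : injective g.
    by apply: (can_inj (g := c)) => i; apply/eqP/(xchooseP (cs i)).
  by rewrite -[m in (m <= _)%N]card_ord; apply: leq_card gI.
have lt : (m < #|G|.+1)%N by [].
apply: (@leq_bigmax_cond _
  (fun m : 'I_#|G|.+1 => [exists c : {ffun G -> 'I_m}, domatic_coloring c])
  (fun m => m : nat) (Ordinal lt)).
by apply/existsP; exists c.
Qed.

Lemma domatic_number_attained (G : sgraph) : (0 < #|G|)%N ->
  exists c : {ffun G -> 'I_(domatic_number G)}, domatic_coloring c.
Proof.
move=> G0.
have lt : (1 < #|G|.+1)%N by [].
pose P (m : 'I_#|G|.+1) := [exists c : {ffun G -> 'I_m}, domatic_coloring c].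
have P1 : P (Ordinal lt).
  apply/existsP; exists [ffun=> ord0]; apply/forallP => i; apply/forallP => x.
  by rewrite inE ffunE (ord1 i).
have -> : domatic_number G = [arg max_(i > Ordinal lt | P i) i].
  by rewrite /domatic_number (bigop.bigmax_eq_arg (Ordinal lt)).
by case: arg_maxnP => // i /existsP.
Qed.

Lemma min_domaticP (R : realType) (k : nat) (C : R) : (0 < k)%N -> 1 <= C ->
  is_minimum (domatic_values k C) (min_domatic k C).
Proof.
move=> k0 C1.
have sy : symmetric (fun x y : 'I_k.+1 => x != y) by move=> x y; rewrite eq_sym.
have ir : irreflexive (fun x y : 'I_k.+1 => x != y) by move=> x; rewrite eqxx.
pose K := SGraph sy ir.
have dK (x : K) : degree x = k.
  rewrite /degree (_ : [set y | adj x y]%SET = [set~ x]%SET).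
    by rewrite cardsC1 card_ord.
  by apply/setP => y; rewrite !inE eq_sym.
have KP : kC_regular k C K.
  split.
    rewrite /min_degree (eq_bigr (fun=> k)) => [|x _]; last exact: dK.
    rewrite big_const card_ord iterS.
    by apply/minn_idPl; elim: (k in iter k) => [|n IH] /=; rewrite ?leq_min ?leqnn.
  rewrite /max_degree (eq_bigr (fun=> k)) => [|x _]; last exact: dK.
  rewrite (@le_trans _ _ k%:R)//; last by rewrite ler_peMr.
  by rewrite ler_nat; apply/bigmax_leqP.
have exm : exists m, `[< domatic_values k C m >].
  by exists (domatic_number K); apply/asboolP; exists K.
apply: (xgetPex 0%N); case: (ex_minnP exm) => m /asboolP mA mm.
by exists m; split=> // n nA; apply/mm/asboolP.
Qed.

(* Main.v *)
(* Put M = (1 - e/2) k / (2 ln k), of which the first m = (1 - e) k / (2 ln k)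
   colours are to become dominating and the other M - m are a reserve.
   Colour the vertices uniformly with M colours.  A given vertex misses a given
   colour in its neighbourhood with probability at most exp (- k / M), less than
   k ^ (-2 - e), so the expected number of colours missed by some neighbour of a
   vertex u is O(k ^ (- e)).  Avoidance of distinct colours is negatively
   correlated, so for a constant t > 5 / e the probability that t colours are
   missed around u is smaller than k ^ (-5), while the event depends on only
   O(k ^ 4) other such events.  By the local lemma, some colouring has fewer
   than t colours missed around every vertex; in particular every neighbourhood
   contains at least M - m - t vertices of reserve colours.
   Now recolour each reserve vertex u uniformly with one of the fewer than t
   colours missed around u.  A colour missed at v lies in the list of every
   reserve neighbour of v, so it stays missed at v with probability at most
   (1 - 1 / t) ^ (M - m - t), and a second use of the local lemma repairs all
   the vertices at once. *)
Require Import Defs.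
From mathcomp Require Import all_boot all_order all_algebra.
From mathcomp Require Import all_classical all_reals all_analysis.
From mathcomp Require Import zify ring lra.

Set Implicit Arguments.
Unset Strict Implicit.
Unset Printing Implicit Defensive.

Import Order.TTheory GRing.Theory Num.Theory.
Import numFieldNormedType.Exports.

(** * Independence and the local lemma, by counting *)

Lemma leq_card_bigcup (I T : finType) (P : pred I) (F : I -> {set T}) :
  #|\bigcup_(i | P i) F i| <= \sum_(i | P i) #|F i|.
Proof.
apply: (big_ind2 (fun (A : {set T}) n => #|A| <= n)) => //; first by rewrite cards0.
by move=> A m B n Am Bn; apply: leq_trans (leq_card_setU _ _) (leq_add Am Bn).
Qed.

Definition depends_on (V K : finType) (A : {set {ffun V -> K}}) (S : {set V}) :=
  forall f g : {ffun V -> K}, {in S, f =1 g} -> (f \in A) = (g \in A).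

Section splice.
Variables (V K : finType) (S : {set V}).
Let splice (f g : {ffun V -> K}) : {ffun V -> K} :=
  [ffun x => if x \in S then f x else g x].

(** Independence: exchanging the values of two functions outside [S] is an involution on pairs that
    maps [A] times [B] onto [A :&: B] times the whole space. *)
Lemma card_setI_depends_on (A B : {set {ffun V -> K}}) :
  depends_on A S -> depends_on B (~: S) ->
  #|A :&: B| * #|{ffun V -> K}| = #|A| * #|B|.
Proof.
move=> hA hB.
pose swap (p : {ffun V -> K} * {ffun V -> K}) :=
  (splice p.1 p.2, splice p.2 p.1).
have swapK : involutive swap.
  by move=> [f g]; congr pair; apply/ffunP => x; rewrite !ffunE; case: (x \in S).
have inA f g : (splice f g \in A) = (f \in A).
  by apply: hA => x xS; rewrite ffunE xS.
have inB f g : (splice f g \in B) = (g \in B).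
  by apply: hB => x; rewrite inE ffunE => /negbTE ->.
rewrite -cardsT -!cardsX -(card_imset (finset.setX A B) (inv_inj swapK)).
apply/eq_card => p.
rewrite -[p in RHS]swapK (mem_imset _ _ (inv_inj swapK)).
by rewrite !inE inA inB !andbT.
Qed.
End splice.

(* The local lemma for the uniform measure on functions V -> K, by counting:
   each bad event has probability at most 1 / (4 D) and meets the support of
   at most D events (itself included). *)
Section local_lemma.
Variables (V K J : finType) (A : J -> {set {ffun V -> K}}) (S : J -> {set V}).
Variable D : nat.
Hypothesis A_S : forall j, depends_on (A j) (S j).
Hypothesis D_gt0 : 0 < D.
Hypothesis S_D : forall j, #|[set l | ~~ [disjoint S j & S l]]| <= D.
Hypothesis A_D : forall j, 4 * D * #|A j| <= #|{ffun V -> K}|.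

Let avoid (T : {set J}) := [set f | [forall j in T, f \notin A j]].

Lemma avoidP (T : {set J}) f :
  reflect (forall j, j \in T -> f \notin A j) (f \in avoid T).
Proof. by rewrite inE; apply: forall_inP. Qed.

(** Given [avoid T], the event [A j] has probability at most [1 / (2 D)]. Let [T1] be the events of
    [T] whose support meets that of [j]. [A j] is independent of [avoid T2], and by induction the at
    most [D] events of [T1] cover at most half of [avoid T2]. *)
Lemma card_bad_avoid (T : {set J}) j :
  2 * D * #|A j :&: avoid T| <= #|avoid T|.
Proof.
have [n] := ubnP #|T|; elim: n => // n IHn in T j *; rewrite ltnS => Tn.
pose T1 := T :&: [set l | ~~ [disjoint S j & S l]].
pose T2 := T :\: T1.
have T12 : avoid T \subset avoid T2.
  apply/fintype.subsetP => f /avoidP fT; apply/avoidP => l.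
  by rewrite inE => /andP[_]; exact: fT.
have indep : 4 * D * #|A j :&: avoid T2| <= #|avoid T2|.
  have [|Om0] := posnP #|{ffun V -> K}|.
    move=> e; have := max_card (mem (A j :&: avoid T2)); rewrite e leqn0.
    by move=> /eqP ->; rewrite muln0.
  rewrite -(leq_pmul2r Om0) -mulnA (@card_setI_depends_on _ _ (S j)) //.
    by rewrite mulnA [leqRHS]mulnC leq_mul2r A_D orbT.
  move=> f g fg; rewrite !inE; apply: eq_forallb_in => l.
  rewrite !inE => /andP[nl lT]; congr negb; apply: A_S => x xl; apply: fg.
  rewrite inE; apply/negP => xj; move: nl; rewrite lT /= negbK.
  by move=> /pred0P/(_ x) /=; rewrite xj xl.
have low : #|avoid T2| <= 2 * #|avoid T|.
  have [T10|T10] := eqVneq T1 finset.set0.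
    by rewrite /T2 T10 finset.setD0 leq_pmull.
  have T2n : #|T2| < n.
    move: T10; rewrite -card_gt0 cardsDS ?finset.subsetIl // => T10.
    by apply: leq_trans Tn; rewrite ltn_subrL T10 (leq_trans T10) // subset_leq_card ?finset.subsetIl.
  have cov : avoid T2 \subset avoid T :|: \bigcup_(l in T1) (A l :&: avoid T2).
    apply/fintype.subsetP => f fT2; rewrite inE.
    have [//|] := boolP (f \in avoid T).
    rewrite {1}inE negb_forall => /existsP[l].
    rewrite negb_imply negbK => /andP[lT fl] /=.
    apply/finset.bigcupP; exists l; last by rewrite finset.in_setI fl fT2.
    apply: contraT => lT1; move/avoidP: fT2 => /(_ l).
    by rewrite inE lT lT1 fl => /(_ isT).
  have cT1 : #|T1| <= D by apply: leq_trans (S_D j); rewrite subset_leq_card ?finset.subsetIr.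
  have sum : 2 * D * #|\bigcup_(l in T1) (A l :&: avoid T2)| <= D * #|avoid T2|.
    apply: leq_trans (_ : \sum_(l in T1) 2 * D * #|A l :&: avoid T2| <= _).
      by rewrite -big_distrr /= leq_mul2l leq_card_bigcup orbT.
    apply: leq_trans (_ : \sum_(l in T1) #|avoid T2| <= _).
      by apply: leq_sum => l _; exact: IHn.
    by rewrite sum_nat_const leq_mul2r cT1 orbT.
  have := leq_trans (subset_leq_card cov) (leq_card_setU _ _).
  nia.
have := subset_leq_card (finset.setIS (A j) T12).
nia.
Qed.

(** Each further event removes at most a fraction [1 / (2 D)] of the functions still allowed, so
    some always remain. *)
Lemma local_lemma : 0 < #|{ffun V -> K}| -> exists f, forall j, f \notin A j.
Proof.
move=> Om0.
suff av (T : {set J}) : 0 < #|avoid T|.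
  have /card_gt0P[f /avoidP fP] := av [set: J]%SET.
  by exists f => j; apply: fP; rewrite inE.
have [n] := ubnP #|T|; elim: n => // n IHn in T *; rewrite ltnS => Tn.
have [->|[j jT]] := set_0Vmem T.
  rewrite (eq_card (B := predT)) // => f; apply/avoidP => j; by rewrite inE.
have /IHn av : #|T :\ j| < n by rewrite [#|T|](cardsD1 j) jT in Tn.
have := card_bad_avoid (T :\ j) j.
have : avoid (T :\ j) \subset avoid T :|: (A j :&: avoid (T :\ j)).
  apply/fintype.subsetP => f fT; rewrite inE orbC [f \in _ :&: _]inE fT andbT.
  case: (boolP (f \in A j)) => //= fj; apply/avoidP => l lT.
  have [->//|lj] := eqVneq l j.
  by move/avoidP: fT; apply; rewrite !inE lj.
move=> /subset_leq_card/leq_trans/(_ (leq_card_setU _ _)).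
nia.
Qed.
End local_lemma.

(** * Functions avoiding prescribed values *)

Lemma bernoulli_le (R : realFieldType) (x : R) n :
  (0 <= x <= 1 -> 1 - n%:R * x <= (1 - x) ^+ n)%R.
Proof.
move=> /andP[x0 x1]; elim: n => [|n IHn]; first by rewrite expr0 mul0r subr0.
rewrite exprS; have := ler_wpM2l (_ : 0 <= 1 - x)%R IHn; rewrite subr_ge0 => /(_ x1).
have : (0 <= n%:R * x * x)%R by rewrite !mulr_ge0.
rewrite -natr1; lra.
Qed.

Section avoiding.
Variables (V K : finType) (S : V -> {set K}).

Definition avoiding := [set f : {ffun V -> K} | [forall x, f x \notin S x]].

Lemma card_avoiding : #|avoiding| = \prod_x (#|K| - #|S x|).
Proof.
rewrite (eq_card (B := family (fun x => [predC S x]))) => [|f].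
  rewrite card_family foldrE big_map big_enum /=.
  by apply: eq_bigr => x _; rewrite -[#|K|](cardC (S x)) addKn.
by rewrite inE; apply: eq_forallb => x; rewrite !inE.
Qed.

(** This is the negative correlation: by Bernoulli, the factor [1 - #|S x| / #|K|] of a coordinate
    is at most what [#|S x|] independent restrictions would give. *)
Lemma card_avoiding_le (R : realFieldType) (n : nat) :
  0 < #|K| -> n <= \sum_x #|S x| ->
  (#|avoiding|%:R <= #|{ffun V -> K}|%:R * (1 - #|K|%:R^-1) ^+ n :> R)%R.
Proof.
move=> K0 nS; have K0R : (0 < #|K|%:R :> R)%R by rewrite ltr0n.
have K01 : (0 <= (#|K|%:R^-1 : R) <= 1)%R.
  by rewrite invr_ge0 ler0n invf_le1 // ler1n.
apply: (@le_trans _ _ (#|{ffun V -> K}|%:R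
    * (1 - #|K|%:R^-1) ^+ (\sum_x #|S x|))%R); last first.
  rewrite ler_wpM2l // ler_wiXn2l //; lra.
rewrite card_avoiding natr_prod card_ffun natrX -prodr_const expr_sum -big_split /=.
apply: ler_prod => x _; rewrite ler0n /=.
have SK : #|S x| <= #|K| by exact: max_card.
apply: le_trans (ler_wpM2l (ltW K0R) (bernoulli_le #|S x| K01)).
by rewrite natrB // mulrBr mulr1 mulrCA divff ?mulr1 ?gt_eqF.
Qed.
End avoiding.

(** * Random colouring of a graph and its repair *)

Section graph.
Variable G : sgraph.

Definition nbhd (A : {set G}) := \bigcup_(x in A) [set y | adj x y].

Lemma in_nbhd (A : {set G}) y : reflect (exists2 x, x \in A & adj x y) (y \in nbhd A).
Proof.
apply: (iffP (finset.bigcupP)) => -[x xA]; rewrite ?inE => xy; exists x => //.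
by rewrite inE.
Qed.

Lemma in_nbhd1 (x y : G) : (y \in nbhd [set x]%SET) = adj x y.
Proof. by rewrite /nbhd finset.big_set1 inE. Qed.

Lemma degree_le (x : G) : degree x <= max_degree G.
Proof. exact: (@leq_bigmax _ (@degree G)). Qed.

(** The iterate collects the endpoints of the walks of length [n] from [x]. *)
Lemma card_iter_nbhd n (x : G) : #|iter n nbhd [set x]%SET| <= max_degree G ^ n.
Proof.
elim: n => [|n IHn]; first by rewrite cards1.
apply: leq_trans (leq_card_bigcup _ _) _.
apply: (@leq_trans (\sum_(y in iter n nbhd [set x]%SET) max_degree G)).
  by apply: leq_sum => y _; exact: degree_le.
by rewrite sum_nat_const expnSr leq_mul2r IHn orbT.
Qed.

Lemma nbhd_sym (A : {set G}) x y :
  x \in A -> x \in nbhd [set y]%SET -> y \in nbhd A.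
Proof. by move=> xA; rewrite in_nbhd1 adj_sym => xy; apply/in_nbhd; exists x. Qed.

Section missing.
Variables (M : nat).
Implicit Type c : {ffun G -> 'I_M}.

(** Only neighbours count, not [v] itself: every vertex, whatever its colour, is to see each final
    colour. *)
Definition missing c v := [set i | [forall x, adj v x ==> (c x != i)]]%SET.

Definition missing_nbhd c u := \bigcup_(w | adj u w) missing c w.

Lemma missingP c v i :
  reflect (forall x, adj v x -> c x != i) (i \in missing c v).
Proof.
rewrite inE; apply: (iffP forallP) => h x; first by move/(implyP (h x)).
by apply/implyP/h.
Qed.

Lemma missing_subset c u v : adj u v -> missing c v \subset missing_nbhd c u.
Proof. by move=> uv; exact: (finset.bigcup_sup v). Qed.

Definition many_missing t u := [set c | t <= #|missing_nbhd c u|].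

Lemma many_missing_depends t u :
  depends_on (many_missing t u) (iter 2 nbhd [set u]%SET).
Proof.
move=> c c' cc'; rewrite !inE; congr (_ <= #|pred_of_set _|).
apply: eq_bigr => w uw; apply/setP => i; rewrite !inE.
apply: eq_forallb => x; case wx : (adj w x) => //=; rewrite cc' //.
by apply/in_nbhd; exists w => //; rewrite in_nbhd1.
Qed.

(** If walks of length 2 from [u] and from [l] share an endpoint, a walk of length 4 joins [u] to
    [l]. *)
Lemma card_overlap2 u :
  #|[set l | ~~ [disjoint iter 2 nbhd [set u] & iter 2 nbhd [set l]]]%SET|
  <= max_degree G ^ 4.
Proof.
apply: leq_trans (card_iter_nbhd 4 u); apply/subset_leq_card/fintype.subsetP => l.
rewrite inE => /pred0Pn[x /andP[xu /in_nbhd[y yl yx]]].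
by apply: nbhd_sym yl; apply: nbhd_sym xu _; rewrite in_nbhd1.
Qed.

Lemma card_overlap1 u :
  #|[set l | ~~ [disjoint nbhd [set u] & nbhd [set l]]]%SET|
  <= max_degree G ^ 2.
Proof.
apply: leq_trans (card_iter_nbhd 2 u); apply/subset_leq_card/fintype.subsetP => l.
by rewrite inE => /pred0Pn[x /andP[xu xl]]; exact: nbhd_sym xu xl.
Qed.

(* Union bound over the t-tuples of pairs (colour, neighbour of u missing it),
   with distinct colours. *)
Lemma card_many_missing (R : realFieldType) k t u : 0 < M ->
  (forall x : G, k <= degree x) ->
  (#|many_missing t u|%:R <= #|{ffun G -> 'I_M}|%:R *
    (M%:R * (max_degree G)%:R * (1 - M%:R^-1) ^+ k) ^+ t :> R)%R.
Proof.
move=> M0 dk.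
pose P (h : {ffun 'I_t -> 'I_M * G}) :=
  injectiveb (fun a => (h a).1) && [forall a, adj u (h a).2].
(* The colours that [h] forbids at [x]: each pair forbids its colour at all neighbours of its
   vertex. *)
pose S (h : {ffun 'I_t -> 'I_M * G}) x :=
  [set (h a).1 | a in [set a | adj (h a).2 x]]%SET.
have cover : many_missing t u \subset \bigcup_(h | P h) avoiding (S h).
  apply/fintype.subsetP => c; rewrite inE => tL.
  pose f a := enum_val (widen_ord tL a).
  have /fin_all_exists[g gP] (a : 'I_t) :
      exists w, adj u w && (f a \in missing c w).
    have /finset.bigcupP[w uw fw] : f a \in missing_nbhd c u by exact: enum_valP.
    by exists w; rewrite uw.
  pose h := [ffun a => (f a, g a)].
  apply/finset.bigcupP; exists h.
    apply/andP; split.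
      apply/injectiveP => a b; rewrite !ffunE /= => /enum_val_inj /(congr1 val) /= ab.
      exact: val_inj.
    by apply/forallP => a; rewrite ffunE /=; case/andP: (gP a).
  rewrite inE; apply/forallP => x; apply/negP => /imsetP[a].
  rewrite inE !ffunE /= => ax cxa; case/andP: (gP a) => _ /missingP/(_ _ ax).
  by rewrite cxa eqxx.
have cardP : #|P| <= (M * max_degree G) ^ t.
  apply: (@leq_trans #|ffun_on (finset.setX [set: 'I_M] [set y | adj u y])
      : {pred {ffun 'I_t -> 'I_M * G}}|).
    apply/subset_leq_card/fintype.subsetP => h /andP[_ /forallP uh].
    by apply/ffun_onP => a; rewrite !inE uh.
  rewrite card_ffun_on cardsX cardsT !card_ord; case: (t) => // n.
  by rewrite leq_exp2r // leq_mul2l degree_le orbT.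
(* As the colours of [h] are distinct, double counting turns the sum into the sum of the degrees of
   its [t] vertices. *)
have cardS h : P h -> k * t <= \sum_x #|S h x|.
  move=> /andP[/injectiveP hI _].
  rewrite (eq_bigr (fun x => \sum_(a | adj (h a).2 x) 1)) => [|x _]; last first.
    by rewrite card_imset // sum1dep_card.
  rewrite (exchange_big_dep predT) //=.
  apply: (@leq_trans (\sum_(a < t) k)); first by rewrite sum_nat_const card_ord mulnC.
  by apply: leq_sum => a _; rewrite sum1dep_card; exact: dk.
rewrite exprMn -exprM.
apply: (@le_trans _ _ (\sum_(h | P h) #|{ffun G -> 'I_M}|%:R
    * (1 - M%:R^-1) ^+ (k * t))%R).
  apply: (@le_trans _ _ (\sum_(h | P h) #|avoiding (S h)|%:R)%R).
    rewrite -natr_sum ler_nat.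
    exact: leq_trans (subset_leq_card cover) (leq_card_bigcup _ _).
  apply: ler_sum => h Ph.
  by have := @card_avoiding_le _ _ (S h) R _ _ (cardS _ Ph); rewrite card_ord; exact.
rewrite sumr_const -[leLHS]mulr_natr -mulrA ler_wpM2l // [leRHS]mulrC ler_wpM2l //.
  rewrite exprn_ge0 // subr_ge0 invf_le1 ?ler1n ?ltr0n //.
by rewrite -natrM -natrX ler_nat.
Qed.

Lemma few_missing (R : realFieldType) k t : 0 < M -> 0 < max_degree G ->
  (forall x : G, k <= degree x) ->
  (4 * (max_degree G)%:R ^+ 4 *
    (M%:R * (max_degree G)%:R * (1 - M%:R^-1) ^+ k) ^+ t <= 1 :> R)%R ->
  exists c, forall u, #|missing_nbhd c u| < t.
Proof.
move=> M0 D0 dk small.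
have D40 : 0 < max_degree G ^ 4 by rewrite expn_gt0 D0.
have [||c cP] := local_lemma (many_missing_depends t) D40 card_overlap2.
- move=> u; rewrite -(ler_nat R) natrM.
  apply: le_trans (ler_wpM2l _ (card_many_missing R t u M0 dk)) _; first exact: ler0n.
  rewrite mulrCA ler_piMr //; apply: le_trans small.
  by rewrite natrM natrX.
- by rewrite card_ffun card_ord expn_gt0 M0.
- by exists c => u; have := cP u; rewrite inE -ltnNge.
Qed.

Section repair.
Variables (m t : nat) (c : {ffun G -> 'I_M}).
Hypothesis c_t : forall u, #|missing_nbhd c u| < t.
Implicit Type d : {ffun G -> 'I_t}.

(** An index [d x] past the end of the list keeps the old colour. This padding to the common length
    [t] makes the choices uniform on functions to ['I_t], as the local lemma requires. *)
Definition repair_color d x : 'I_M := nth (c x) (enum (missing_nbhd c x)) (d x).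

Definition unrepaired v : {set {ffun G -> 'I_t}} :=
  \bigcup_(i in missing c v)
    [set d | [forall x, adj v x && (m <= c x) ==> (repair_color d x != i)]]%SET.

Lemma unrepaired_depends v : depends_on (unrepaired v) (nbhd [set v]%SET).
Proof.
move=> d d' dd'.
apply/finset.bigcupP/finset.bigcupP => -[i im]; rewrite inE => h; exists i => //;
  rewrite inE; move: h; congr is_true; apply: eq_forallb => x;
  case vx : (adj v x) => //=; by rewrite /repair_color dd' // in_nbhd1.
Qed.

(** Each of the [M - m] reserve colours not missed at [v] occurs on a neighbour of [v], distinct
    colours on distinct neighbours. *)
Lemma card_reserve v :
  M - m - #|missing c v| <= #|[set x | adj v x && (m <= c x)]%SET|.
Proof.
have sub : [set i : 'I_M | m <= i] :\: missing c v \subset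
    c @: [set x | adj v x && (m <= c x)].
  apply/fintype.subsetP => i; rewrite !inE negb_forall => /andP[/existsP[x]].
  rewrite negb_imply negbK => /andP[vx /eqP <-] mi.
  by apply: imset_f; rewrite inE vx.
apply: leq_trans (leq_imset_card c _); apply: leq_trans (subset_leq_card sub).
rewrite cardsD; apply: leq_sub; last by rewrite subset_leq_card ?finset.subsetIr.
rewrite -[M - m]muln1 -sum_nat_const_nat (big_nat_widenl _ 0) // big_mkord.
by rewrite sum1dep_card.
Qed.

Lemma card_unrepaired (R : realFieldType) v : 0 < degree v ->
  (#|unrepaired v|%:R <= #|{ffun G -> 'I_t}|%:R *
     (t%:R * (1 - t%:R^-1) ^+ (M - m - t)) :> R)%R.
Proof.
(* Any neighbour [u] of [v] bounds the number of colours missed at [v], since all of them are in its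
   list. *)
move=> /card_gt0P[u]; rewrite inE adj_sym => uv.
have mt : #|missing c v| < t.
  by apply: leq_ltn_trans (c_t u); rewrite subset_leq_card ?missing_subset.
have t0 : 0 < t by apply: leq_trans mt.
(* At a reserve neighbour of [v] this is the one index that selects [i]; elsewhere it is empty. *)
pose S i x := [set j : 'I_t | [&& adj v x, m <= c x &
  val j == index i (enum (missing_nbhd c x))]]%SET.
have cover : unrepaired v \subset \bigcup_(i in missing c v) avoiding (S i).
  apply/fintype.subsetP => d /finset.bigcupP[i im]; rewrite inE => /forallP dP.
  apply/finset.bigcupP; exists i => //; rewrite inE; apply/forallP => x.
  rewrite inE; apply/negP => /and3P[vx mx /eqP dx].
  move/implyP: (dP x); rewrite vx mx /= => /(_ isT); rewrite /repair_color dx.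
  rewrite nth_index ?eqxx // mem_enum.
  by apply: (fintype.subsetP (missing_subset c _)) im; rewrite adj_sym.
have cardS i : i \in missing c v -> M - m - t <= \sum_x #|S i x|.
  move=> im; apply: (@leq_trans #|[set x | adj v x && (m <= c x)]%SET|).
    exact: leq_trans (leq_sub2l _ (ltnW mt)) (card_reserve v).
  rewrite -sum1dep_card big_mkcond /=; apply: leq_sum => x _.
  case: ifP => // /andP[vx mx]; apply/card_gt0P.
  have it : index i (enum (missing_nbhd c x)) < t.
    apply: leq_trans (c_t x); rewrite ltnS cardE ltnW // index_mem mem_enum.
    by apply: (fintype.subsetP (missing_subset c _)) im; rewrite adj_sym.
  by exists (Ordinal it); rewrite inE vx mx /=.
apply: (@le_trans _ _ (\sum_(i in missing c v) #|{ffun G -> 'I_t}|%:R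
    * (1 - t%:R^-1) ^+ (M - m - t))%R).
  apply: (@le_trans _ _ (\sum_(i in missing c v) #|avoiding (S i)|%:R)%R).
    rewrite -natr_sum ler_nat.
    exact: leq_trans (subset_leq_card cover) (leq_card_bigcup _ _).
  apply: ler_sum => i im.
  by have := @card_avoiding_le _ _ (S i) R _ _ (cardS _ im); rewrite card_ord; exact.
rewrite sumr_const -[leLHS]mulr_natl mulrCA ler_wpM2l // ler_wpM2r //.
  rewrite exprn_ge0 // subr_ge0 invf_le1 ?ler1n ?ltr0n //.
by rewrite ler_nat ltnW.
Qed.

Lemma repairable (R : realFieldType) :
  0 < t -> 0 < max_degree G -> (forall x : G, 0 < degree x) ->
  (4 * (max_degree G)%:R ^+ 2 * (t%:R * (1 - t%:R^-1) ^+ (M - m - t)) <= 1 :> R)%R ->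
  exists d, forall v, d \notin unrepaired v.
Proof.
move=> t0 D0 d0 small.
have D20 : 0 < max_degree G ^ 2 by rewrite expn_gt0 D0.
apply: (local_lemma unrepaired_depends D20 card_overlap1).
- move=> u; rewrite -(ler_nat R) natrM.
  apply: le_trans (ler_wpM2l _ (card_unrepaired R (d0 u))) _; first exact: ler0n.
  rewrite mulrCA ler_piMr //; apply: le_trans small.
  by rewrite natrM natrX.
- by rewrite card_ffun card_ord expn_gt0 t0.
Qed.

(** Only reserve vertices are recoloured, so a colour below [m] that [c] shows to [v] is still seen;
    the repair supplies those that [c] misses. *)
Lemma repaired_coloring d : 0 < m -> m <= M -> (forall v, d \notin unrepaired v) ->
  exists f : {ffun G -> 'I_m}, domatic_coloring f.
Proof.
move=> m0 mM dP.
pose color x : 'I_M := if c x < m then c x else repair_color d x.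
(* Vertices still carrying a reserve colour go to class 0; enlarging a class keeps it dominating. *)
exists [ffun x => insubd (Ordinal m0) (val (color x))].
apply/forallP => i; apply/forallP => v; apply/implyP => _.
suff [x vx cx] : exists2 x, adj v x & color x = widen_ord mM i.
  apply/exists_inP; exists x => //; rewrite inE ffunE cx.
  by apply/eqP/val_inj; rewrite val_insubd /= ltn_ord.
case: (boolP (widen_ord mM i \in missing c v)) => [im|].
  have [x] : exists x, ~~ (adj v x && (m <= c x) ==>
      (repair_color d x != widen_ord mM i)).
    apply/existsP; rewrite -negb_forall; apply: contra (dP v) => h.
    by apply/finset.bigcupP; exists (widen_ord mM i) => //; rewrite inE.
  rewrite negb_imply negbK => /andP[/andP[vx mx] /eqP e].
  by exists x => //; rewrite /color ltnNge mx.
rewrite inE negb_forall => /existsP[x].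
rewrite negb_imply negbK => /andP[vx /eqP e].
by exists x => //; rewrite /color e /= ltn_ord.
Qed.
End repair.
End missing.

Lemma le_domatic_number (R : realFieldType) (k m M t : nat) :
  0 < k -> 0 < m <= M -> 0 < t -> 0 < #|G| -> (forall x : G, k <= degree x) ->
  (4 * (max_degree G)%:R ^+ 4 *
    (M%:R * (max_degree G)%:R * (1 - M%:R^-1) ^+ k) ^+ t <= 1 :> R)%R ->
  (4 * (max_degree G)%:R ^+ 2 * (t%:R * (1 - t%:R^-1) ^+ (M - m - t)) <= 1 :> R)%R ->
  m <= domatic_number G.
Proof.
move=> k0 /andP[m0 mM] t0 G0 dk h1 h2.
have d0 (x : G) : 0 < degree x := leq_trans k0 (dk x).
have D0 : 0 < max_degree G.
  by have /card_gt0P[x _] := G0; exact: leq_trans (d0 x) (degree_le x).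
have [c cP] := few_missing (leq_trans m0 mM) D0 dk h1.
have [d dP] := repairable cP t0 D0 d0 h2.
by have [f] := repaired_coloring m0 mM dP; exact: leq_domatic_number.
Qed.
End graph.

Lemma min_degree_le (G : sgraph) (x : G) : min_degree G <= degree x.
Proof.
rewrite /min_degree; have := mem_index_enum x.
elim: (index_enum _) => // y r IHr; rewrite inE big_cons geq_min.
by move=> /predU1P[->|/IHr ->]; rewrite ?leqnn ?orbT.
Qed.

(** A positive minimum degree thus rules out the empty graph. *)
Lemma min_degree_leq_card (G : sgraph) : min_degree G <= #|G|.
Proof.
apply: (big_ind (fun d => d <= #|G|)) => // [d e dG _|x _].
  by rewrite geq_min dG.
exact: max_card.
Qed.

Local Open Scope ring_scope.

(** * Numerical estimates for large [k], with [L = ln k] *)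

Lemma expr_1BV_le (R : realType) (n e : nat) : (0 < n)%N ->
  (1 - n%:R^-1) ^+ e <= expR (- (e%:R / n%:R)) :> R.
Proof.
move=> n0; rewrite -mulrN expRM_natl lerXn2r ?nnegrE ?expR_ge0 //.
  by rewrite subr_ge0 invf_le1 ?ler1n ?ltr0n.
exact: expR_ge1Dx.
Qed.

(** The cube of [x / 3 <= expR (x / 3)]. *)
Lemma expR_ge_cube (R : realType) (x : R) : 0 <= x -> x ^+ 3 / 27 <= expR x.
Proof.
move=> x0; have -> : x = 3%:R * (x / 3) by lra.
rewrite expRM_natl.
have -> : (3%:R * (x / 3)) ^+ 3 / 27 = (x / 3) ^+ 3 :> R by field.
by have h := expR_ge1Dx (x / 3); rewrite lerXn2r ?nnegrE ?expR_ge0 //; lra.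
Qed.

Lemma natr_subn_ge (R : realDomainType) (m n : nat) : m%:R - n%:R <= (m - n)%:R :> R.
Proof.
have [mn|/ltnW nm] := leqP m n; last by rewrite natrB.
by apply: (@le_trans _ _ 0); rewrite ?ler0n // subr_le0 ler_nat.
Qed.

Section large_degree.
Variables (R : realType) (C e L : R) (k t : nat) (G : sgraph).
Hypotheses (C_ge1 : 1 <= C) (e_gt0 : 0 < e) (e_lt1 : e < 1) (kL : expR L = k%:R).
Hypothesis regG : kC_regular k C G.
Hypothesis et : 5 <= e * t%:R.
Hypothesis L_t : 108 * (4 * t%:R + 2) <= e * L.
Hypothesis L_C1 : 4 * C ^+ (4 + t) <= L.
Hypothesis L_C2 : 4 * C ^+ 2 * t%:R <= L.

Let a := k%:R / (2 * L).
(** [M] is rounded down to keep [k / M] large, [m] up to reach [(1 - e) * a]. *)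
Let M := Num.trunc ((1 - e / 2) * a).
Let m := (Num.trunc ((1 - e) * a)).+1.

Let L_ge4 : 4 <= L.
Proof. by apply: le_trans L_C1; rewrite ler_peMr // exprn_ege1. Qed.

Let k_gt0 : (0 < k)%N.
Proof. by rewrite -(ltr0n R) -kL expR_gt0. Qed.

Let a_gt0 : 0 < a.
Proof. by rewrite divr_gt0 ?ltr0n // mulr_gt0 // (lt_le_trans _ L_ge4). Qed.

Let aL : a * (2 * L) = k%:R.
Proof. by rewrite divfK // mulf_neq0 // gt_eqF // (lt_le_trans _ L_ge4). Qed.

(** Up to a rounding error of 2, the reserve [M - m] is [e * a / 2]; this leaves [3 * t * L] of it
    after removing [t]. The cubic bound on [k = expR L] gives [a >= L ^ 2 / 54], whence the constant
    108 in [L_t]. *)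
Let a_ge : e * a >= 2 * (3 * t%:R * L + t%:R + 2).
Proof.
have L0 : 0 < L by apply: lt_le_trans L_ge4.
have kL3 : L ^+ 3 / 27 <= k%:R by rewrite -kL expR_ge_cube // ltW.
have aL2 : L ^+ 2 / 54 <= a.
  rewrite /a ler_pdivlMr ?mulr_gt0 //; apply: le_trans kL3.
  by have -> : L ^+ 2 / 54 * (2 * L) = L ^+ 3 / 27 by field.
have t0 : 0 <= t%:R :> R by [].
have h : 108 * (4 * t%:R + 2) * L <= e * L ^+ 2 by rewrite expr2 mulrA ler_wpM2r // ltW.
have h2 : e * (L ^+ 2 / 54) <= e * a by rewrite ler_wpM2l // ltW.
have h3 : t%:R * 1 <= t%:R * L by rewrite ler_wpM2l //; move: L_ge4; lra.
move: L_ge4; lra.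
Qed.

Let M_le : M%:R <= (1 - e / 2) * a.
Proof. by rewrite truncn_le // mulr_ge0 ?(ltW a_gt0) //; move: e_gt0 e_lt1; lra. Qed.

Let M_gt : (1 - e / 2) * a < M%:R + 1.
Proof. by rewrite natr1 truncnS_gt. Qed.

Let m_ge : (1 - e) * a <= m%:R.
Proof. by rewrite ltW // truncnS_gt. Qed.

Let m_le : m%:R <= (1 - e) * a + 1.
Proof. by rewrite -natr1 lerD2r truncn_le // mulr_ge0 ?(ltW a_gt0) //; move: e_gt0 e_lt1; lra. Qed.

Let mMt : 3 * t%:R * L <= (M - m - t)%:R.
Proof.
apply: le_trans (natr_subn_ge _ _ _).
have := natr_subn_ge R M m; move: a_ge M_gt m_le; lra.
Qed.

Let D_le : (max_degree G)%:R <= C * expR L.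
Proof. by rewrite mulrC kL; case: regG. Qed.

Let t_gt0 : (0 < t)%N.
Proof. by rewrite lt0n; apply/eqP => t0; move: et; rewrite t0; lra. Qed.

Let mM : (m <= M)%N.
Proof.
rewrite -(ler_nat R); move: a_ge M_gt m_le L_ge4 => h1 h2 h3 h4.
have : 0 <= t%:R * L by rewrite mulr_ge0 //; lra.
have : 0 <= t%:R :> R by [].
lra.
Qed.

Let M_gt0 : (0 < M)%N.
Proof. exact: leq_trans mM. Qed.

Let few_missing_cond :
  4 * (max_degree G)%:R ^+ 4 *
    (M%:R * (max_degree G)%:R * (1 - M%:R^-1) ^+ k) ^+ t <= 1 :> R.
Proof.
have L0 : 0 < L by apply: lt_le_trans L_ge4.
(* [(2 + e) * (1 - e / 2) = 2 - e ^ 2 / 2] is at most 2, so [k / M] is at least [(2 + e) * L]. *)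
have q_le : (1 - M%:R^-1) ^+ k <= expR (- ((2 + e) * L)) :> R.
  apply: le_trans (expr_1BV_le R k M_gt0) _.
  rewrite ler_expR lerN2 ler_pdivlMr ?ltr0n // -aL.
  apply: (@le_trans _ _ ((2 + e) * L * ((1 - e / 2) * a))).
    by rewrite ler_wpM2l // mulr_ge0 // ?ltW //; move: e_gt0; lra.
  have : 0 <= e ^+ 2 * (a * L) by rewrite mulr_ge0 ?sqr_ge0 // mulr_ge0 ?ltW.
  lra.
have M_leL : M%:R <= expR L.
  apply: le_trans M_le _; rewrite kL -aL.
  have : 0 <= a * (2 * L - 1) by rewrite mulr_ge0 ?ltW //; move: L_ge4; lra.
  have : 0 <= e * a by rewrite mulr_ge0 ?ltW.
  lra.
have q0 : 0 <= (1 - M%:R^-1) ^+ k :> R.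
  by rewrite exprn_ge0 // subr_ge0 invf_le1 ?ler1n ?ltr0n.
have X_le : M%:R * (max_degree G)%:R * (1 - M%:R^-1) ^+ k <= C * expR (- (e * L)).
  apply: (@le_trans _ _ (expR L * (C * expR L) * expR (- ((2 + e) * L)))).
    by apply: ler_pM => //; rewrite ?mulr_ge0 //; apply: ler_pM.
  rewrite [_ * (C * _)]mulrCA -!mulrA ler_wpM2l ?(le_trans _ C_ge1) //.
  by rewrite -!expRD ler_expR; lra.
apply: (@le_trans _ _ (4 * (C * expR L) ^+ 4 * (C * expR (- (e * L))) ^+ t)).
  apply: ler_pM; rewrite ?mulr_ge0 ?exprn_ge0 ?mulr_ge0 //.
    by rewrite ler_wpM2l // lerXn2r ?nnegrE ?mulr_ge0 ?expR_ge0 ?(le_trans _ C_ge1).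
  by rewrite lerXn2r ?nnegrE ?mulr_ge0 ?expR_ge0 ?(le_trans _ C_ge1).
rewrite !exprMn -!expRM_natl mulrA.
have -> : 4 * (C ^+ 4 * expR (4%:R * L)) * C ^+ t * expR (t%:R * - (e * L)) =
  4 * C ^+ (4 + t) * expR (4%:R * L + t%:R * - (e * L)).
  by rewrite exprD expRD; ring.
apply: (@le_trans _ _ (L * expR (- L))).
  apply: (ler_pM _ (expR_ge0 _) L_C1); first by rewrite mulr_ge0 ?exprn_ge0 // (le_trans _ C_ge1).
  (* By [et] the exponent is at most [4 * L - 5 * L]; the spare [expR (- L)] absorbs the constants,
     bounded by [L]. *)
  by rewrite ler_expR; have := ler_wpM2r (ltW L0) et; lra.
by rewrite expRN ler_pdivrMr ?expR_gt0 // mul1r; have := expR_ge1Dx L; lra.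
Qed.

Let repairable_cond :
  4 * (max_degree G)%:R ^+ 2 * (t%:R * (1 - t%:R^-1) ^+ (M - m - t)) <= 1 :> R.
Proof.
(* The exponent [3 * L] exceeds by [L] the [2 * L] coming from the squared maximum degree. *)
have q_le : (1 - t%:R^-1) ^+ (M - m - t) <= expR (- (3 * L)) :> R.
  apply: le_trans (expr_1BV_le R _ t_gt0) _.
  by rewrite ler_expR lerN2 ler_pdivlMr ?ltr0n // mulrAC.
have q0 : 0 <= (1 - t%:R^-1) ^+ (M - m - t) :> R.
  by rewrite exprn_ge0 // subr_ge0 invf_le1 ?ler1n ?ltr0n.
apply: (@le_trans _ _ (4 * (C * expR L) ^+ 2 * (t%:R * expR (- (3 * L))))).
  apply: ler_pM; rewrite ?mulr_ge0 //; rewrite ler_wpM2l //.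
  by rewrite lerXn2r ?nnegrE ?mulr_ge0 ?expR_ge0 ?(le_trans _ C_ge1).
rewrite exprMn -expRM_natl.
have -> : 4 * (C ^+ 2 * expR (2%:R * L)) * (t%:R * expR (- (3 * L))) =
  4 * C ^+ 2 * t%:R * expR (- L).
  have -> : - L = 2%:R * L - 3 * L by lra.
  by rewrite expRD; ring.
apply: (@le_trans _ _ (L * expR (- L))); first by rewrite ler_wpM2r ?expR_ge0.
by rewrite expRN ler_pdivrMr ?expR_gt0 // mul1r; have := expR_ge1Dx L; lra.
Qed.

Lemma domatic_number_ge : (1 - e) * (k%:R / (2 * L)) <= (domatic_number G)%:R.
Proof.
case: regG => dk _; apply: le_trans m_ge _; rewrite ler_nat.
apply: (le_domatic_number k_gt0 _ t_gt0 _ _ few_missing_cond repairable_cond).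
- by rewrite mM.
- by apply: leq_trans k_gt0 _; rewrite -dk; exact: min_degree_leq_card.
- by move=> x; rewrite -dk; exact: min_degree_le.
Qed.
End large_degree.

Local Open Scope classical_set_scope.

(** * Passage to the limit *)

Lemma min_domatic_ge (R : realType) (C e : R) : 1 <= C -> 0 < e -> e < 1 ->
  \forall k \near \oo,
    (1 - e) * (k%:R / (2 * ln k%:R)) <= (min_domatic k C)%:R.
Proof.
move=> C1 e0 e1.
pose t := (Num.trunc (5 / e)).+1.
have et : 5 <= e * t%:R by rewrite mulrC -ler_pdivrMr // ltW // truncnS_gt.
(* This threshold for [ln k] depends on [C] and [e] only, hence serves all graphs at once. *)
pose L0 := Num.max (108 * (4 * t%:R + 2) / e)
  (Num.max (4 * C ^+ (4 + t)) (4 * C ^+ 2 * t%:R)).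
near=> k.
have k0 : (0 < k)%N by near: k; exact: nbhs_infty_gt.
have kL : expR (ln k%:R) = k%:R :> R by rewrite lnK // posrE ltr0n.
have L0k : L0 <= ln k%:R.
  rewrite -ler_expR kL; near: k; exact: nbhs_infty_ger.
move: L0k; rewrite !ge_max => /and3P[h1 h2 h3].
have [[G [regG <-]] _] := min_domaticP k0 C1.
apply: (domatic_number_ge C1 e0 e1 kL regG et _ h2 h3).
by rewrite [leRHS]mulrC -ler_pdivrMr.
Unshelve. all: by end_near. Qed.

Theorem theorem1p1 (R : realType) (C : R) (hC : 1 <= C) :
  exists o1 : nat -> R,
    o1 @ \oo --> (0 : R) /\
    \forall k \near \oo,
      k%:R / (2 * ln k%:R) * (1 + o1 k) <= (min_domatic k C)%:R.
Proof.
pose a k : R := k%:R / (2 * ln k%:R).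
(* Capping the relative error at 0 lets its convergence follow from lower bounds alone. *)
exists (fun k => Num.min 0 ((min_domatic k C)%:R / a k - 1)).
have a0 : \forall k \near \oo, 0 < a k.
  near=> k; have k1 : (1 < k)%N by near: k; exact: nbhs_infty_gt.
  by rewrite divr_gt0 ?mulr_gt0 ?ln_gt0 ?ltr1n // ltr0n ltnW.
split.
  (* The cap 1/2 keeps [e'] below 1, as [min_domatic_ge] requires. *)
  apply/cvgrPdist_le => e e0; pose e' := Num.min e (1 / 2).
  have e'0 : 0 < e' by rewrite lt_min e0; lra.
  have e'1 : e' < 1 by rewrite gt_min orbC; apply/orP; left; lra.
  near=> k.
  have ak : 0 < a k by near: k.
  have : (1 - e') * a k <= (min_domatic k C)%:R by near: k; exact: min_domatic_ge.
  rewrite -ler_pdivlMr // => h.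
  rewrite sub0r normrN ler0_norm ?ge_min ?lexx // lerNl le_min oppr_le0 (ltW e0) /=.
  have : e' <= e by rewrite ge_min lexx.
  lra.
near=> k; have ak : 0 < a k by near: k.
rewrite -/(a k) mulrC -ler_pdivlMr // -lerBrDl ge_min lexx orbT.
Unshelve. all: by end_near. Qed.
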